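(* Let $X$ be a complete metric space, $k\ge 2$, and let $\mathcal{F}=\{f_1,\dots,f_k\}$ be a finite family of similitudes of $X$ with similarity ratios $c_1,\dots,c_k\in(0,1)$. Let $\mathcal{K}$ be the attractor of $\mathcal{F}$, $\alpha$ its similarity dimension, and $\mathbf{\Gamma}$ the natural fractal structure on $\mathcal{K}$. Then $$\mathcal{H}_{\mathrm H}^{\alpha}(\mathcal{K})>0\ \Rightarrow\ \mathrm{SOSC}\ \Rightarrow\ \dim_{\mathrm H}(\mathcal{K})=\alpha\ \Rightarrow\ \mathrm{WSC}\ \Leftrightarrow\ \mathcal{H}_4^{\alpha}(\mathcal{K})>0\ \Leftrightarrow\ \dim_{\mathbf{\Gamma}}^{4}(\mathcal{K})=\alpha .$$
   Context: A similitude of $(X,\rho)$ with ratio $c_i\in(0,1)$ is a map $f_i:X\to X$ with $\rho(f_i(x),f_i(y))=c_i\,\rho(x,y)$ for all $x,y$. The attractor $\mathcal{K}\subseteq X$ is the unique nonempty compact set with $\mathcal{K}=\bigcup_{i=1}^k f_i(\mathcal{K})$. The similarity dimension $\alpha>0$ is the unique solution of $\sum_{i=1}^k c_i^{\alpha}=1$. $\mathcal{H}_{\mathrm H}^{\alpha}$ and $\dim_{\mathrm H}$ are the $\alpha$-dimensional Hausdorff measure and the Hausdorff dimension. Let $\Sigma=\{1,\dots,k\}$; for $\mathbf{i}=i_1\cdots i_n\in\Sigma^n$ put $f_{\mathbf{i}}=f_{i_1}\circ\cdots\circ f_{i_n}$. The natural fractal structure on $\mathcal{K}$ is $\mathbf{\Gamma}=\{\Gamma_n\}_{n\in\mathbb{N}}$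 ($n\ge1$) with $\Gamma_n=\{f_{\mathbf{i}}(\mathcal{K}):\mathbf{i}\in\Sigma^n\}$. A set may appear more than once in a level, so $\Gamma_n$ is regarded as a family indexed by $\Sigma^n$. $\mathrm{OSC}$: there is a nonempty open set $V\subseteq X$ such that the sets $f_i(V)$, $i=1,\dots,k$, are pairwise disjoint and contained in $V$ (a feasible open set). $\mathrm{SOSC}$: there is such a feasible open set $V$ with, in addition, $V\cap\mathcal{K}\ne\emptyset$. $\mathrm{WSC}$ (weak separation condition): $\mathbf{\Gamma}$ is irreducible, i.e. for each $n$ the covering $\Gamma_n$ of $\mathcal{K}$ has no proper subcovering (for every $\mathbf{i}\in\Sigma^n$, $\bigcup_{\mathbf{j}\in\Sigma^n,\,\mathbf{j}\neq\mathbf{i}}f_{\mathbf{j}}(\mathcal{K})\ne\mathcal{K}$). For $s\ge0$ and $n\ge1$ let $\mathcal{H}_{n,4}^s(\mathcal{K})=\inf\sum_{i\in I}\mathrm{diam}(A_i)^s$, the infimum over all finite families $\{A_i\}_{i\in I}$ with $A_i\in\bigcup_{l\ge n}\Gamma_l$ and $\mathcal{K}\subseteq\bigcup_{i\in I}A_i$. Let $\mathcal{H}_4^s(\mathcal{K})=\lim_{n\to\infty}\mathcal{H}_{n,4}^s(\mathcal{K})$, and let the fractal dimension IV be $\dim_{\mathbf{\Gamma}}^4(\mathcal{K})=\inf\{s\ge0:\mathcal{H}_4^s(\mathcal{K})=0\}=\sup\{s\ge0:\mathcal{H}_4^s(\mathcal{K})=\infty\}$ (with $\sup\emptyset=0$).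 *)

(* Defs.v *)
From HB Require Import structures.
From mathcomp Require Export all_boot all_order all_algebra.
From mathcomp Require Export all_classical all_reals all_analysis.

Set Implicit Arguments.
Unset Strict Implicit.
Unset Printing Implicit Defensive.

Import Order.TTheory GRing.Theory Num.Theory.

Local Open Scope classical_set_scope.
Local Open Scope ring_scope.

#[short(type="completeMetricType")]
HB.structure Definition CompleteMetric (R : numDomainType) :=
  { T of Metric R T & Complete T }.

Section hausdorff.
Context {R : realType} {X : metricType R}.
Implicit Types (A : set X) (s d : R).
Local Open Scope ereal_scope.

(* The maximum with 0 only matters for the empty set, whose diameter is 0. *)
Definition diam A : \bar R :=
  maxe 0 (ereal_sup [set (mdist x y)%:E | x in A & y in A]).

(* diam(A)^s, with diam(set0)^s = 0 also for s = 0; a nonempty set of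
   diameter 0 has diam(A)^0 = 1. *)
Definition diam_pow s A : \bar R :=
  if A == set0 then 0 else poweR (diam A) s.

Definition hausdorff_pre s d A : \bar R :=
  ereal_inf [set \sum_(0 <= n <oo) diam_pow s (U n) | U in
    [set U : nat -> set X |
      (forall n, diam (U n) <= d%:E) /\ A `<=` \bigcup_n U n]].

Definition hausdorff_measure s A : \bar R :=
  lim (hausdorff_pre s d A @[d --> 0^'+]).

Definition hausdorff_dim A : \bar R :=
  ereal_inf [set s%:E | s in
    [set s : R | (0 <= s)%R /\ hausdorff_measure s A = 0]].

End hausdorff.

Section fractal_structure.
Context {R : realType} {X : metricType R} (k : nat).
(* Level n of a fractal structure is a family indexed by the words of length n
   over 'I_k, so that a set may occur several times in a level. *)
Variables (Gamma : forall n : nat, n.-tuple 'I_k -> set X) (K : set X).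
Implicit Types s : R.

Definition irreducible_structure : Prop :=
  forall n, (0 < n)%N -> forall i : n.-tuple 'I_k,
    \bigcup_(j in [set j : n.-tuple 'I_k | j != i]) Gamma j <> K.

Local Open Scope ereal_scope.

Definition fractal_pre4 s (n : nat) : \bar R :=
  ereal_inf [set h | exists (m : nat) (A : 'I_m -> set X),
    [/\ forall i, exists l (w : l.-tuple 'I_k), (n <= l)%N /\ A i = Gamma w,
        K `<=` \bigcup_i A i
      & h = \sum_(i < m) diam_pow s (A i)]].

Definition fractal_measure4 s : \bar R := limn (fractal_pre4 s).

Definition fractal_dim4 : \bar R :=
  ereal_inf [set s%:E | s in
    [set s : R | (0 <= s)%R /\ fractal_measure4 s = 0]].

End fractal_structure.

Section self_similar.
Context {R : realType} {X : metricType R} (k : nat).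
Variables (f : 'I_k -> X -> X) (c : 'I_k -> R) (K : set X).

Definition similitude (r : R) (g : X -> X) : Prop :=
  forall x y, mdist (g x) (g y) = r * mdist x y.

Definition is_attractor : Prop :=
  [/\ K !=set0, compact K & K = \bigcup_i (f i @` K)].

Definition is_similarity_dim (alpha : R) : Prop :=
  0 < alpha /\ \sum_(i < k) c i `^ alpha = 1.

Definition word_map (w : seq 'I_k) (x : X) : X := foldr f x w.

Definition natural_structure (n : nat) (w : n.-tuple 'I_k) : set X :=
  word_map w @` K.

Definition feasible_open (V : set X) : Prop :=
  [/\ open V, V !=set0, trivIset setT (fun i => f i @` V)
    & forall i, f i @` V `<=` V].

Definition SOSC : Prop :=
  exists V : set X, feasible_open V /\ V `&` K !=set0.

Definition WSC : Prop := irreducible_structure natural_structure K.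

End self_similar.

(* Main.v *)
From mathcomp Require Import lra.
Require Import Defs.

(* Writing p_i = c_i^alpha, the cylinder f_w(K) carries the weight p_w, and the
   weights of the words of a given length sum to 1.
   - If the level-n pieces other than f_i(K) already cover K, iterating this
     subcover, which satisfies \sum c^s < 1 also for some s < alpha, shows that
     H_4^s(K), and a fortiori H_H^s(K), vanishes.  If no such subcover exists,
     then for every cover of K by pieces each long word extends a word of the
     cover, so the weights of the cover sum to at least 1.
   - Under SOSC some piece f_w(K) lies in the feasible set V, so the f_{uw}(K)
     with |u| = n are at positive distance from each other, and for s < alpha
     and n large \sum_u c_{uw}^s >= 1.  Induction on the size of a finite cover
     then bounds its s-sum from below, without any measure theory.
   - If H_H^alpha(K) > 0, let kappa be the infimum of \sum diam(U)^alpha over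
     the finite covers of K.  Given an antichain W of words with pieces inside
     B, cover K by B and by copies of a nearly optimal cover in the remaining
     cylinders: this yields kappa * \sum_W p_w <= diam(B)^alpha, hence a uniform
     bound on the number of neighbors of a piece of comparable size.  For a word
     w with the maximal number of neighbors, the neighbors of uw are exactly the
     words uv with v a neighbor of w, and the union over u of the
     c_{uw}/2-neighborhoods of f_{uw}(K) is a feasible open set (Schief). *)

Import Order.TTheory GRing.Theory Num.Theory.
Import numFieldNormedType.Exports.

Set Implicit Arguments.
Unset Strict Implicit.
Unset Printing Implicit Defensive.

Local Open Scope classical_set_scope.
Local Open Scope ring_scope.

(** * Diameters, and distances between compact sets *)

Section diameter.
Context {R : realType} {X : metricType R}.
Implicit Types (A B : set X) (s r : R).
Local Open Scope ereal_scope.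

Lemma diam_ge0 A : 0 <= diam A.
Proof. by rewrite /diam le_max lexx. Qed.

Lemma mdist_le_diam A x y : A x -> A y -> (mdist x y)%:E <= diam A.
Proof.
move=> Ax Ay; rewrite /diam le_max; apply/orP; right.
by apply: ereal_sup_ubound; exists x => //; exists y.
Qed.

Lemma diam_le A (e : \bar R) : 0 <= e ->
  (forall x y, A x -> A y -> (mdist x y)%:E <= e) -> diam A <= e.
Proof.
move=> e0 Ae; rewrite /diam ge_max e0/=.
by apply: ge_ereal_sup => _ [x Ax [y Ay <-]]; exact: Ae.
Qed.

Lemma diamS A B : A `<=` B -> diam A <= diam B.
Proof.
move=> AB; apply: diam_le; first exact: diam_ge0.
by move=> x y /AB Bx /AB By; exact: mdist_le_diam.
Qed.

Lemma diam_set0 : diam (set0 : set X) = 0.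
Proof. by apply/eqP; rewrite eq_le diam_ge0 andbT; apply: diam_le. Qed.

Lemma diam_pow_ge0 s A : 0 <= diam_pow s A.
Proof. by rewrite /diam_pow; case: ifP => // _; exact: poweR_ge0. Qed.

Lemma diam_pow_set0 s : diam_pow s (set0 : set X) = 0.
Proof. by rewrite /diam_pow eqxx. Qed.

Lemma diam_powE s A : A !=set0 -> diam_pow s A = poweR (diam A) s.
Proof. by rewrite /diam_pow => /set0P/negbTE ->. Qed.

Lemma diam_pow_le s A (e : \bar R) : (0 <= s)%R ->
  diam A <= e -> diam_pow s A <= poweR e s.
Proof.
move=> s0 Ae; rewrite /diam_pow; case: ifP => _; first exact: poweR_ge0.
have e0 : 0 <= e := le_trans (diam_ge0 A) Ae.
by apply: gt0_ler_poweR; rewrite // in_itv/= leey andbT// diam_ge0.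
Qed.

Lemma diam_powS s A B : (0 <= s)%R -> A `<=` B -> diam_pow s A <= diam_pow s B.
Proof.
move=> s0 AB; have [->|/set0P[x Ax]] := eqVneq A set0.
  by rewrite diam_pow_set0 diam_pow_ge0.
rewrite (@diam_powE _ B); last by exists x; exact: AB.
by apply: diam_pow_le => //; exact: diamS.
Qed.

Lemma diam_image r (g : X -> X) A : (0 < r)%R -> similitude r g ->
  diam (g @` A) = r%:E * diam A.
Proof.
move=> r0 gr; apply/eqP; rewrite eq_le; apply/andP; split.
  apply: diam_le; first by rewrite mule_ge0 ?diam_ge0 ?lee_fin ?(ltW r0).
  move=> _ _ [x Ax <-] [y Ay <-]; rewrite gr EFinM lee_pmul2l ?lte_fin//.
  exact: mdist_le_diam.
rewrite -lee_pdivlMl//; apply: diam_le.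
  by rewrite mule_ge0 ?diam_ge0 ?lee_fin ?invr_ge0 ?(ltW r0).
move=> x y Ax Ay; rewrite lee_pdivlMl// -EFinM -gr.
by apply: mdist_le_diam; exact: imageP.
Qed.

Lemma diam_pow_image s r (g : X -> X) A : (0 < r)%R -> similitude r g ->
  diam_pow s (g @` A) = (r `^ s)%:E * diam_pow s A.
Proof.
move=> r0 gr; have [->|/set0P A0] := eqVneq A set0.
  by rewrite image_set0 !diam_pow_set0 mule0.
rewrite !diam_powE//; last by case: A0 => x Ax; exists (g x); exact: imageP.
by rewrite (diam_image _ r0 gr) poweRM ?diam_ge0 ?lee_fin ?(ltW r0).
Qed.

Lemma similitude_inj r (g : X -> X) : (0 < r)%R -> similitude r g -> injective g.
Proof.
move=> r0 gr x y gxy; apply: mdist_positivity; apply/eqP.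
have := gr x y; rewrite gxy mdistxx => /esym/eqP.
by rewrite mulf_eq0 gt_eqF.
Qed.

Lemma continuous_mdist : continuous (fun p : X * X => mdist p.1 p.2 : R).
Proof.
move=> [a b]; apply/cvgrPdist_lt => e e0 /=.
near=> p; rewrite ltr_norml.
have p1 : (mdist a p.1 < e / 2)%R.
  near: p; exists (ball a (e / 2), setT) => /=.
    by split; [apply: nbhsx_ballx; rewrite divr_gt0|exact: filterT].
  by move=> [x y] /= []; rewrite ballEmdist.
have p2 : (mdist b p.2 < e / 2)%R.
  near: p; exists (setT, ball b (e / 2)) => /=.
    by split; [exact: filterT|apply: nbhsx_ballx; rewrite divr_gt0].
  by move=> [x y] /= []; rewrite ballEmdist.
have h1 := metric_triangle a p.1 b; have h2 := metric_triangle p.1 p.2 b.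
have h3 := metric_triangle p.1 a p.2; have h4 := metric_triangle a b p.2.
have s1 := metric_sym p.1 a; have s2 := metric_sym p.2 b.
by apply/andP; split; lra.
Unshelve. all: by end_near. Qed.

Lemma compact_mdist A B : compact A -> compact B ->
  compact ((fun p : X * X => mdist p.1 p.2 : R) @` (A `*` B)).
Proof.
move=> cA cB; apply: continuous_compact; last exact: compact_setX.
by apply: continuous_subspaceT; exact: continuous_mdist.
Qed.

Lemma compact_diam A : compact A -> exists2 D : R, (0 <= D)%R & diam A = D%:E.
Proof.
move=> cA; suff : diam A < +oo.
  move=> dA; exists (fine (diam A)); first by rewrite fine_ge0 ?diam_ge0.
  by rewrite fineK// ge0_fin_numE ?diam_ge0.
have [M [_ /(_ (`|M| + 1)%R)]] := compact_bounded (compact_mdist cA cA).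
have -> : (M < `|M| + 1)%R by rewrite (le_lt_trans (ler_norm _))// ltrDl.
move=> /(_ isT) AM; apply: (@le_lt_trans _ _ (`|M| + 1)%:E); last exact: ltry.
apply: diam_le; first by rewrite lee_fin addr_ge0.
move=> x y Ax Ay; rewrite lee_fin (le_trans (ler_norm _))//.
by apply: AM; exists (x, y).
Qed.

(** The distances between points of [A] and points of [B] form a compact, hence closed, set of
    reals, and disjointness keeps 0 out of it. *)
Lemma compact_disjoint_mdist A B : compact A -> compact B ->
  A `&` B = set0 ->
  exists2 e : R, (0 < e)%R & forall x y, A x -> B y -> (e <= mdist x y)%R.
Proof.
move=> cA cB AB; set D := (fun p : X * X => mdist p.1 p.2 : R) @` (A `*` B).
have cD : closed D := compact_closed (@norm_hausdorff _ _) (compact_mdist cA cB).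
have D0 : (~` D) 0%R.
  move=> [[x y]/= [Ax By] /mdist_positivity xy].
  by rewrite -[False]/(set0 x) -AB; split => //; rewrite xy.
have /nbhs_ballP[e /= e0 eD] : nbhs (0%R : R) (~` D).
  by apply: open_nbhs_nbhs; split => //; exact: closed_openC.
exists e => // x y Ax By; rewrite leNgt; apply/negP => xye.
apply: (eD (mdist x y)); last by exists (x, y).
by rewrite /ball/= sub0r normrN ger0_norm// mdist_ge0.
Qed.

End diameter.

(* [compact_cover] needs a pointed space. *)
Lemma compact_countable_cover {T : topologicalType} (A : set T)
    (V : nat -> set T) : compact A -> (forall n, open (V n)) ->
  A `<=` \bigcup_n V n -> exists N, A `<=` \bigcup_(n in `I_N) V n.
Proof.
move=> cA oV AV; apply: contrapT => noN.
pose B N := A `\` \bigcup_(n in `I_N) V n.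
have B0 N : B N !=set0.
  apply: contrapT => BN0; apply: noN; exists N => x Ax.
  by apply: contrapT => xV; apply: BN0; exists x.
have FB : ProperFilter (filter_from setT B).
  apply: filter_from_proper => [|N _]; last exact: B0.
  apply: filter_fromT_filter => [|i j]; first by exists 0%N.
  exists (maxn i j) => x [Ax xV]; split; split => // -[n /= ni Vn]; apply: xV;
    exists n => //=; by rewrite leq_max ni ?orbT.
have [|p [Ap]] := cA _ FB; first by exists 0%N => // x [].
move=> /(_ (B _) (V _)) clp; have [n _ Vnp] := AV _ Ap.
have [||x [[_ xV] Vnx]] := clp n.+1 n; first by exists n.+1.
  exact: open_nbhs_nbhs.
by apply: xV; exists n => /=.
Qed.

(** * Finite covers and the vanishing of Hausdorff measure *)

Section finite_covers.
Context {R : realType} {X : metricType R}.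
Implicit Types (A B U : set X) (s r : R) (L : seq (set X)).
Local Open Scope ereal_scope.

Definition finite_cover A L := forall x, A x -> exists2 U, U \in L & U x.

(** Diameters are not restricted. For compact sets and positive [s] this content vanishes exactly
    when the [s]-dimensional Hausdorff measure does, so it can replace the measure in all arguments
    below. *)
Definition finite_content s A : \bar R :=
  ereal_inf [set \sum_(U <- L) diam_pow s U | L in finite_cover A].

Lemma finite_content_ge0 s A : 0 <= finite_content s A.
Proof.
by apply: le_ereal_inf_tmp => _ [L _ <-]; apply: sume_ge0 => U _; exact: diam_pow_ge0.
Qed.

Lemma hausdorff_pre_ge0 s d A : 0 <= hausdorff_pre s d A.
Proof.
apply: le_ereal_inf_tmp => _ [U _ <-]; apply: nneseries_ge0 => n _ _.
exact: diam_pow_ge0.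
Qed.

Lemma hausdorff_pre_le s d d' A : (d <= d')%R ->
  hausdorff_pre s d' A <= hausdorff_pre s d A.
Proof.
move=> dd'; apply: ereal_inf_le_tmp => _ [U [Ud AU] <-]; exists U => //; split => //.
by move=> n; rewrite (le_trans (Ud n))// lee_fin.
Qed.

(** The pre-measures grow as the mesh shrinks, so the right limit at 0 is a supremum; the upper end
    1 is arbitrary. *)
Lemma hausdorff_measureE s A :
  hausdorff_measure s A = ereal_sup [set hausdorff_pre s d A | d in `]0%R, 1%R[].
Proof.
apply: cvg_lim => //; apply: nonincreasing_at_right_cvge; first by rewrite bnd_simp.
by move=> x y _ _ xy; exact: hausdorff_pre_le.
Qed.

Lemma hausdorff_pre_le_measure s d A : (0 < d < 1)%R ->
  hausdorff_pre s d A <= hausdorff_measure s A.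
Proof.
by move=> d01; rewrite hausdorff_measureE; apply: ereal_sup_ubound; exists d => //=.
Qed.

Lemma nneseries_nth (L : seq (set X)) s :
  \sum_(0 <= n <oo) diam_pow s (nth set0 L n) = \sum_(U <- L) diam_pow s U.
Proof.
rewrite (big_nth set0); apply: lim_near_cst => //.
exists (size L) => // n /= Ln.
rewrite (@big_cat_nat _ _ _ (size L))//=.
rewrite [X in _ + X]big_nat_cond [X in _ + X]big1 ?adde0//.
by move=> i /andP[/andP[Li _] _]; rewrite nth_default// diam_pow_set0.
Qed.

(** A cover whose [s]-sum is below [d^s] consists of sets of diameter at most [d], so small content
    respects the mesh automatically. *)
Lemma hausdorff_measure_eq0 s A : (0 < s)%R -> finite_content s A = 0 ->
  hausdorff_measure s A = 0.
Proof.
move=> s0 A0; rewrite hausdorff_measureE.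
suff pre0 d : (0 < d)%R -> hausdorff_pre s d A <= 0.
  apply/eqP; rewrite eq_le; apply/andP; split.
    by apply: ge_ereal_sup => _ [d /= /[!in_itv]/= /andP[d0 _] <-]; exact: pre0.
  apply: (@le_trans _ _ (hausdorff_pre s 2^-1 A)); first exact: hausdorff_pre_ge0.
  by apply: ereal_sup_ubound; exists (2^-1)%R => //=; rewrite in_itv/=; lra.
move=> d0; apply/lee_addgt0Pr => e e0; rewrite add0e.
(* The bound [e] makes the sum small; the bound [d^s] controls the diameters. *)
have ed0 : (0 < Num.min e (d `^ s))%R by rewrite lt_min e0 powR_gt0.
have : finite_content s A < (Num.min e (d `^ s))%:E by rewrite A0 lte_fin.
move=> /ereal_inf_lt[_ [L AL <-]].
rewrite EFin_min lt_min => /andP[/ltW Le Ld].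
apply: le_trans Le; rewrite -nneseries_nth; apply: ereal_inf_lbound.
exists (nth set0 L) => //; split => [n|x /AL[U UL Ux]]; last first.
  by exists (index U L) => //; rewrite nth_index.
have [Ln|nL] := leqP (size L) n.
  by rewrite nth_default// diam_set0 lee_fin ltW.
have [->|/set0P Un0] := eqVneq (nth set0 L n) set0.
  by rewrite diam_set0 lee_fin ltW.
rewrite leNgt; apply/negP => dU; move: Ld; apply/negP; rewrite -leNgt.
apply: (@le_trans _ _ (diam_pow s (nth set0 L n))); last first.
  rewrite (big_rem (nth set0 L n)) ?mem_nth//= leeDl// sume_ge0// => U _.
  exact: diam_pow_ge0.
rewrite diam_powE// -poweR_EFin.
apply: gt0_ler_poweR; rewrite ?in_itv/= ?leey ?andbT.
- exact: ltW.
- by rewrite lee_fin ltW.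
- exact: diam_ge0.
- exact: ltW.
Qed.

Lemma open_enlargement s U (e : R) : (0 <= s)%R -> (0 < e)%R ->
  exists V, [/\ open V, U `<=` V & diam_pow s V <= diam_pow s U + e%:E].
Proof.
move=> + e0; have [->|/set0P U0] := eqVneq U set0.
  exists set0; split => //; first exact: open0.
  by rewrite diam_pow_set0 add0e lee_fin ltW.
rewrite le_eqVlt => /predU1P[<-|s0].
  (* For [s = 0] every nonempty set contributes 1, so the whole space costs nothing extra. *)
  exists setT; split => //; first exact: openT.
  rewrite !diam_powE//; last by case: U0 => x _; exists x.
  by rewrite !poweRe0 leeDl// lee_fin ltW.
have [dU|] := boolP (diam U < +oo); last first.
  rewrite -leNgt leye_eq => /eqP dU; exists setT; split => //; first exact: openT.
  by rewrite (diam_powE _ U0) dU poweRyr ?gt_eqF// addye ?leey.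
set a := fine (diam U).
have aE : diam U = a%:E by rewrite fineK// ge0_fin_numE ?diam_ge0.
have a0 : (0 <= a)%R by rewrite fine_ge0 ?diam_ge0.
(* [b] is the diameter whose [s]-th power is the allowed value; fattening [U] by [(b - a) / 2] on
   each side stays within it. *)
pose b := ((a `^ s + e) `^ s^-1)%R.
have bs : (b `^ s = a `^ s + e)%R.
  by rewrite /b -powRrM mulVf ?gt_eqF// powRr1// addr_ge0 ?powR_ge0// ltW.
have ab : (a < b)%R.
  rewrite ltNge; apply/negP => ba.
  have := ge0_ler_powR (ltW s0) _ _ ba; rewrite !nnegrE powR_ge0 a0 bs.
  by move=> /(_ isT isT); rewrite gerDl leNgt e0.
pose h := ((b - a) / 2)%R; have h0 : (0 < h)%R by rewrite divr_gt0// subr_gt0.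
exists (\bigcup_(x in U) (ball x h)°); split.
- by apply: bigcup_open => x _; exact: open_interior.
- by move=> x Ux; exists x => //; exact: nbhsx_ballx.
have -> : diam_pow s U + e%:E = poweR b%:E s.
  by rewrite (diam_powE _ U0) aE !poweR_EFin bs.
apply: diam_pow_le; first exact: ltW.
apply: diam_le; first by rewrite lee_fin powR_ge0.
move=> x y [x' Ux' /interior_subset]; rewrite ballEmdist/= => xx'.
move=> [y' Uy' /interior_subset]; rewrite ballEmdist/= => yy'.
have := mdist_le_diam Ux' Uy'; rewrite aE !lee_fin => x'y'.
have h1 := metric_triangle x x' y; have h2 := metric_triangle x' y' y.
have h3 := metric_sym x x'; move: xx' yy'; rewrite /h; lra.
Qed.

(** The members of a nearly optimal countable cover are enlarged to open sets with geometrically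
    decreasing errors, and compactness leaves finitely many of them. *)
Lemma finite_content_eq0 s A : (0 <= s)%R -> compact A ->
  hausdorff_measure s A = 0 -> finite_content s A = 0.
Proof.
move=> s0 cA HA; apply/eqP; rewrite eq_le finite_content_ge0 andbT.
apply/lee_addgt0Pr => e e0; rewrite add0e.
have e20 : (0 < e / 2)%R by rewrite divr_gt0.
have : hausdorff_pre s 2^-1 A < (e / 2)%:E.
  apply: (@le_lt_trans _ _ 0); last by rewrite lte_fin.
  by rewrite -HA; apply: hausdorff_pre_le_measure; lra.
move=> /ereal_inf_lt[_ [U [_ AU] <-]] Ue.
have en n : (0 < e / 2 / (2 ^ n.+1)%:R)%R by rewrite divr_gt0// ltr0n expn_gt0.
have /choice[V UV] : forall n, exists V, [/\ open V, U n `<=` V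
    & diam_pow s V <= diam_pow s (U n) + (e / 2 / (2 ^ n.+1)%:R)%:E].
  by move=> n; exact: open_enlargement.
have [||N AN] := compact_countable_cover cA (V := V).
- by move=> n; have [] := UV n.
- by move=> x /AU[n _ Unx]; exists n => //; have [_ UVn _] := UV n; exact: UVn.
apply: ge_ereal_inf; exists (\sum_(W <- map V (iota 0 N)) diam_pow s W).
  exists (map V (iota 0 N)) => // x /AN[n /= nN Vnx]; exists (V n) => //.
  by apply: map_f; rewrite mem_iota.
rewrite big_map -[N]subn0 -/(index_iota 0 N).
apply: (@le_trans _ _ (\sum_(0 <= n <oo) diam_pow s (V n))).
  by apply: nneseries_lim_ge => n _ _; exact: diam_pow_ge0.
apply: (@le_trans _ _ (\sum_(0 <= n <oo)
   (diam_pow s (U n) + (e / 2 / (2 ^ n.+1)%:R)%:E))).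
  apply: lee_nneseries => n _; first by rewrite diam_pow_ge0.
  by have [] := UV n.
apply: (le_trans (epsilon_trick _ _ _)) => [n||]; [exact: diam_pow_ge0|exact: ltW|].
by rewrite [in leRHS](splitr e) EFinD leeD2r// ltW.
Qed.

End finite_covers.

(** * Words, prefixes and product weights *)

Lemma prefix_size_le (T : eqType) (u v w : seq T) :
  prefix v u -> prefix w u -> (size v <= size w)%N -> prefix v w.
Proof.
rewrite !prefixE => /eqP vu /eqP wu vw.
by rewrite -[X in take _ X == _]wu take_takel// vu.
Qed.

Section word_weights.
Context {R : realType} {k : nat}.
Implicit Types (p c : 'I_k -> R) (u v w : seq 'I_k) (W : seq (seq 'I_k)).

(** Used with [p = c], where it is the ratio of the composed similitude, and with [p = c^s], where
    it is the [s]-th power of that ratio. *)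
Definition weight p w : R := \prod_(a <- w) p a.

Lemma weight_nil p : weight p [::] = 1.
Proof. by rewrite /weight big_nil. Qed.

Lemma weight_cons p a w : weight p (a :: w) = p a * weight p w.
Proof. by rewrite /weight big_cons. Qed.

Lemma weight_cat p u w : weight p (u ++ w) = weight p u * weight p w.
Proof. by rewrite /weight big_cat. Qed.

Lemma weight_rcons p w a : weight p (rcons w a) = weight p w * p a.
Proof. by rewrite /weight big_rcons/= mulrC. Qed.

Lemma weight_ge0 p w : (forall a, 0 <= p a) -> 0 <= weight p w.
Proof. by move=> p0; apply: prodr_ge0. Qed.

Lemma weight_gt0 p w : (forall a, 0 < p a) -> 0 < weight p w.
Proof. by move=> p0; apply: prodr_gt0. Qed.

Lemma weight_le1 p w : (forall a, 0 < p a < 1) -> weight p w <= 1.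
Proof.
by move=> p01; apply: prodr_ile1 => a _; have /andP[/ltW -> /ltW] := p01 a.
Qed.

Lemma weight_lt1 p w : (forall a, 0 < p a < 1) -> w != [::] -> weight p w < 1.
Proof.
case: w => // a w p01 _; rewrite weight_cons.
have /andP[p0 p1] := p01 a.
have w0 := @weight_gt0 p w (fun a => proj1 (andP (p01 a))).
by rewrite (le_lt_trans _ p1)// ger_pMr// weight_le1.
Qed.

Lemma weight_powR c w (s : R) : (forall a, 0 < c a) ->
  weight c w `^ s = weight (fun a => c a `^ s) w.
Proof.
move=> c0; elim: w => [|a w IH]; first by rewrite !weight_nil powR1.
by rewrite !weight_cons powRM ?(ltW (c0 a)) ?(ltW (weight_gt0 _ _))// IH.
Qed.

Lemma sum_tuple_cons n (F : n.+1.-tuple 'I_k -> R) :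
  \sum_u F u = \sum_a \sum_(t : n.-tuple 'I_k) F (cons_tuple a t).
Proof.
rewrite pair_big/= (reindex (fun q : 'I_k * n.-tuple 'I_k => cons_tuple q.1 q.2))//=.
exists (fun u : n.+1.-tuple 'I_k => (thead u, [tuple of behead u])) =>
  [[a t] _|u _] /=.
  by congr pair; apply: val_inj.
by rewrite [RHS]tuple_eta; apply: val_inj.
Qed.

Lemma sum_weight p n : \sum_(u : n.-tuple 'I_k) weight p u = (\sum_a p a) ^+ n.
Proof.
elim: n => [|n IH].
  rewrite expr0 (eq_bigr (fun=> 1)) => [|u _]; last by rewrite tuple0 weight_nil.
  by rewrite sumr_const card_tuple expn0.
rewrite sum_tuple_cons exprS -IH mulr_suml; apply: eq_bigr => a _.
by rewrite mulr_sumr; apply: eq_bigr => t _; rewrite weight_cons.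
Qed.

(** Consistency of the Bernoulli weights: the mass of a cylinder is spread over its descendants at
    level [n]. *)
Lemma sum_weight_prefix p n v : \sum_a p a = 1 -> (size v <= n)%N ->
  \sum_(u : n.-tuple 'I_k | prefix v u) weight p u = weight p v.
Proof.
move=> p1; elim: n v => [|n IH] [|b v]// vn.
- by under eq_bigl do rewrite prefix0s; rewrite sum_weight p1 expr1n weight_nil.
- by under eq_bigl do rewrite prefix0s; rewrite sum_weight p1 expr1n weight_nil.
- rewrite big_mkcond sum_tuple_cons (bigD1 b)//= [X in _ + X]big1 ?addr0.
    rewrite weight_cons -(IH v)// mulr_sumr [RHS]big_mkcond; apply: eq_bigr => t _.
    by rewrite eqxx/= weight_cons.
  by move=> a /negbTE ab; rewrite big1// => t _; rewrite eq_sym ab.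
Qed.

(** Double counting: each weight is expanded over level [n], so a word [u] is counted once for every
    prefix it has in [W]. *)
Lemma sum_weight_exchange p n W : \sum_a p a = 1 ->
  (forall w, w \in W -> (size w <= n)%N) ->
  \sum_(w <- W) weight p w =
  \sum_(u : n.-tuple 'I_k) weight p u *+ count (fun w => prefix w u) W.
Proof.
move=> p1 Wn.
rewrite big_seq (eq_bigr (fun w =>
  \sum_(u : n.-tuple 'I_k | prefix w u) weight p u)).
  rewrite -big_seq; under eq_bigr do rewrite big_mkcond.
  rewrite exchange_big/=; apply: eq_bigr => u _.
  by rewrite -big_mkcond/= big_const_seq iter_addr addr0.
by move=> w /Wn wn; rewrite sum_weight_prefix.
Qed.

Lemma sum_weight_ge1 p n W : (forall a, 0 <= p a) -> \sum_a p a = 1 ->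
  (forall w, w \in W -> (size w <= n)%N) ->
  (forall u : n.-tuple 'I_k, has (fun w => prefix w u) W) ->
  1 <= \sum_(w <- W) weight p w.
Proof.
move=> p0 p1 Wn hW; rewrite (sum_weight_exchange p1 Wn) -[leLHS](expr1n _ n) -p1.
rewrite -sum_weight; apply: ler_sum => u _.
by rewrite -[leLHS]mulr1n; apply: ler_wpMn2l; rewrite ?weight_ge0// -has_count.
Qed.

(** Each word of level [n] has at most one prefix in the antichain; those with none make up the
    second sum. *)
Lemma sum_weight_antichain p n W : (forall a, 0 <= p a) -> \sum_a p a = 1 ->
  (forall w, w \in W -> (size w <= n)%N) -> uniq W ->
  {in W &, forall v w, prefix v w -> v = w} ->
  \sum_(w <- W) weight p w +
  \sum_(u : n.-tuple 'I_k | ~~ has (fun w => prefix w u) W) weight p u <= 1.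
Proof.
move=> p0 p1 Wn uW aW; rewrite (sum_weight_exchange p1 Wn).
rewrite -[leRHS](expr1n _ n) -p1 -sum_weight [X in _ + X]big_mkcond -big_split/=.
apply: ler_sum => u _.
have [hu|nu] := boolP (has _ W); last first.
  by move: nu; rewrite has_count -leqNgt leqn0 => /eqP ->; rewrite mulr0n add0r.
rewrite addr0 -[leRHS]mulr1n; apply: ler_wpMn2l; first exact: weight_ge0.
have /hasP[v vW vu] := hu.
(* Two prefixes of [u] are comparable, hence equal in an antichain, so only [v] is counted. *)
rewrite (eq_in_count (a2 := pred1 v)) ?count_uniq_mem ?leq_b1// => w wW /=.
apply/idP/eqP => [wu|->//].
have [vw|/ltnW wv] := leqP (size v) (size w).
  by apply/esym/aW => //; exact: prefix_size_le vu wu vw.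
by apply: aW => //; exact: prefix_size_le wu vu wv.
Qed.

End word_weights.

Lemma expr_lt_eventually {R : realType} (q e : R) : 0 <= q < 1 -> 0 < e ->
  exists2 n, (0 < n)%N & q ^+ n < e.
Proof.
move=> /andP[q0 q1] e0; have q1' : `|q| < 1 by rewrite ger0_norm.
have [N _ NP] := cvgr_lt _ (cvg_expr q1') _ e0.
by exists N.+1 => //; apply: NP => /=.
Qed.

Lemma similitude_continuous {R : realType} {X : metricType R} (r : R) (g : X -> X) :
  0 < r -> similitude r g -> continuous g.
Proof.
move=> r0 gr x A /nbhs_ballP[e /= e0 eA]; apply/nbhs_ballP.
exists (e / r) => /=; first exact: divr_gt0.
move=> y; rewrite ballEmdist/= => xy; apply: eA.
by rewrite ballEmdist/= gr mulrC -ltr_pdivlMr.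
Qed.

(** * A lower bound for covers of a set with separated similar copies *)

Section separated_similitudes.
Context {R : realType} {X : metricType R} {J : finType}.
Context (g : J -> X -> X) (r : J -> R) (A : set X) (s e : R).

(** Induction on the size of the cover. A member of diameter at least [e] suffices alone. Otherwise
    each member meets at most one copy [g j @] A[, so the cover splits into disjoint parts; pulled
    back by the]g j[, these are shorter covers of]A[, and scaling recovers the bound because the]r j
    [^ s] sum to at least 1. *)
Lemma separated_cover_bound : A !=set0 -> 0 <= s -> 0 < e -> (1 < #|J|)%N ->
  (forall j, 0 < r j) -> (forall j, similitude (r j) (g j)) ->
  (forall j, g j @` A `<=` A) -> 1 <= \sum_j r j `^ s ->
  (forall i j, i != j -> forall x y, A x -> A y -> e <= mdist (g i x) (g j y)) ->
  forall L, finite_cover A L -> ((e `^ s)%:E <= \sum_(U <- L) diam_pow s U)%E.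
Proof.
move=> [x0 Ax0] s0 e0 J2 r0 gr gA r1 sep L.
have [n Ln] := ubnP (size L); elim: n => // n IH in L Ln *.
move=> AL.
have [/hasP[U UL eU]|/hasPn smallL] := boolP (has (fun U => e%:E <= diam U)%E L).
  apply: (@le_trans _ _ (diam_pow s U)); last first.
    by rewrite (big_rem U)//= leeDl// sume_ge0// => V _; exact: diam_pow_ge0.
  rewrite diam_powE -?poweR_EFin.
    by apply: gt0_ler_poweR; rewrite ?in_itv/= ?leey ?andbT ?diam_ge0// lee_fin ltW.
  apply/set0P/eqP => U0; move: eU; rewrite U0 diam_set0 lee_fin.
  by rewrite leNgt e0.
pose meets j (U : set X) := `[< exists2 x, A x & U (g j x) >].
have meets1 U i j : U \in L -> meets i U -> meets j U -> i = j.
  move=> UL /asboolP[x Ax Ux] /asboolP[y Ay Uy]; apply/eqP; apply: contraT => ij.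
  have := smallL _ UL; rewrite -ltNge => dU.
  have := le_lt_trans (mdist_le_diam Ux Uy) dU.
  by rewrite lte_fin ltNge sep.
pose Lj j := [seq g j @^-1` U | U <- L & meets j U].
have coverj j : finite_cover A (Lj j).
  move=> x Ax; have /AL[U UL Ux] : A (g j x) by apply: gA; exact: imageP.
  exists (g j @^-1` U) => //; apply: map_f; rewrite mem_filter UL andbT.
  by apply/asboolP; exists x.
have sizej j : (size (Lj j) < size L)%N.
  rewrite size_map size_filter ltn_neqAle count_size andbT -all_count.
  have [i ij] : exists i, i != j.
    have /card_gt1P[i [k [_ _ ik]]] := J2.
    by have [ij|] := eqVneq i j; [exists k; rewrite -ij eq_sym|exists i].
  have /AL[U UL Ux] : A (g i x0) by apply: gA; exact: imageP.
  apply/allPn; exists U => //; apply/negP => jU; move/eqP: ij; apply.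
  by apply: (meets1 U) => //; apply/asboolP; exists x0.
have IHj j := IH (Lj j) (leq_trans (sizej j) Ln) (coverj j).
(* After exchanging the sums, each [U] occurs for at most one [j]. *)
apply: (@le_trans _ _ (\sum_j \sum_(U <- L | meets j U) diam_pow s U)%E); last first.
  rewrite (exchange_big_dep xpredT)//= [leLHS]big_seq [leRHS]big_seq.
  apply: lee_sum => U UL; have [j jU|noj] := pickP (meets ^~ U); last first.
    by rewrite big_pred0// diam_pow_ge0.
  rewrite (big_pred1 j)// => i /=; apply/idP/eqP => [iU|->//].
  exact: (meets1 U).
apply: (@le_trans _ _ (\sum_j (r j `^ s * e `^ s)%:E)%E).
  by rewrite sumEFin lee_fin -mulr_suml ler_peMl// powR_ge0.
apply: lee_sum => j _; rewrite EFinM.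
apply: (@le_trans _ _ ((r j `^ s)%:E * \sum_(U <- Lj j) diam_pow s U)%E).
  by rewrite lee_wpmul2l// lee_fin powR_ge0.
rewrite big_map big_filter ge0_sume_distrr => [|U _]; last exact: diam_pow_ge0.
apply: lee_sum => U _; rewrite -(diam_pow_image _ _ (r0 j) (gr j)).
by apply: diam_powS => // _ [x Ux <-].
Qed.

End separated_similitudes.

(** Nearly optimal elements give [h <= a + q * h] for the infimum [h]. With [a = 0] and [q < 1] it
    forces [h = 0]; with [a] the cost of one extra set it bounds a content. *)
Lemma ereal_inf_contraction {R : realType} (S : set (\bar R)) (a q : R) :
  0 <= q -> ereal_inf S \is a fin_num -> (forall x, S x -> 0 <= x)%E ->
  (forall x, S x -> (ereal_inf S <= a%:E + q%:E * x)%E) ->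
  (1 - q) * fine (ereal_inf S) <= a.
Proof.
move=> q0 /fineK Sh S0 Sq; set h := fine _ in Sh *.
have q1 : 0 < q + 1 by rewrite ltr_wpDl.
suff : h <= a + q * h by move=> ?; rewrite mulrBl mul1r lerBlDr.
apply/ler_addgt0Pr => e e0.
(* Dividing by [q + 1] makes the error at most [e] after multiplication by [q], also when
   [q = 0]. *)
have : (ereal_inf S < (h + e / (q + 1))%:E)%E by rewrite -Sh lte_fin ltrDl divr_gt0.
move=> /ereal_inf_lt[x Sx xh]; have := Sq _ Sx; have := S0 _ Sx.
case: x Sx xh => [x| |]// _; rewrite lte_fin -Sh lee_fin => xh x0.
rewrite -EFinM -EFinD lee_fin => /le_trans; apply.
rewrite -addrA lerD2l; apply: (@le_trans _ _ (q * (h + e / (q + 1)))).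
  by rewrite ler_wpM2l// ltW.
rewrite mulrDr lerD2l mulrA ler_pdivrMr// mulrC ler_pM2l//; lra.
Qed.

(** * Pieces of the attractor and covers by pieces *)

Section self_similar_set.
Context {R : realType} {X : metricType R} {k : nat}.
Context (f : 'I_k -> X -> X) (c : 'I_k -> R) (K : set X).
Context (c01 : forall i, 0 < c i < 1) (fc : forall i, similitude (c i) (f i)).
Context (Katt : is_attractor f K).
Implicit Types (s : R) (v w : seq 'I_k) (W : seq (seq 'I_k)) (x y : X).

Definition piece w := word_map f w @` K.

Definition word_cover W := forall x, K x -> exists2 w, w \in W & piece w x.

Lemma c_gt0 i : 0 < c i. Proof. by have /andP[] := c01 i. Qed.

Lemma c_ge0 i : 0 <= c i. Proof. exact/ltW/c_gt0. Qed.

Lemma word_map_cat u v x : word_map f (u ++ v) x = word_map f u (word_map f v x).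
Proof. exact: foldr_cat. Qed.

Lemma similitude_word w : similitude (weight c w) (word_map f w).
Proof.
elim: w => [|a w IH] x y; first by rewrite weight_nil mul1r.
by rewrite weight_cons /= fc IH mulrA.
Qed.

Lemma diam_word w (A : set X) :
  diam (word_map f w @` A) = ((weight c w)%:E * diam A)%E.
Proof. by apply: diam_image (similitude_word w); apply: weight_gt0 c_gt0. Qed.

Lemma diam_pow_word s w (A : set X) : diam_pow s (word_map f w @` A) =
  ((weight (fun a => c a `^ s) w)%:E * diam_pow s A)%E.
Proof.
rewrite -(weight_powR _ _ c_gt0); apply: diam_pow_image (similitude_word w).
exact: weight_gt0 c_gt0.
Qed.

Lemma word_map_attractor w x : K x -> K (word_map f w x).
Proof.
have [_ _ KE] := Katt; move=> Kx; elim: w => //= a w IH.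
by rewrite KE; exists a => //; exact: imageP.
Qed.

Lemma piece_sub w : piece w `<=` K.
Proof. by move=> _ [x Kx <-]; exact: word_map_attractor. Qed.

Lemma piece_cat u v : piece (u ++ v) = word_map f u @` piece v.
Proof.
by rewrite /piece image_comp; apply: eq_imagel => x _; rewrite word_map_cat.
Qed.

Lemma piece_prefix u v : prefix u v -> piece v `<=` piece u.
Proof.
move=> /prefixP[t ->]; rewrite piece_cat => _ [x tx <-].
by apply: imageP; exact: piece_sub tx.
Qed.

Lemma attractor_words n x : K x -> exists u : n.-tuple 'I_k, piece u x.
Proof.
have [_ _ KE] := Katt.
elim: n x => [|n IH] x Kx; first by exists [tuple]; exists x.
move: (Kx); rewrite {1}KE => -[i _ [y Ky yx]]; have [u [z Kz zy]] := IH _ Ky.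
by exists (cons_tuple i u); exists z => //=; rewrite zy.
Qed.

Lemma diam_pow_attractor_fin s : diam_pow s K \is a fin_num.
Proof.
have [K0 cK _] := Katt; have [D D0 KD] := compact_diam cK.
by rewrite diam_powE// KD.
Qed.

(** Families of sets become lists of words, and scaling factors [diam_pow s K] out of the sum. *)
Lemma fractal_pre4E s n : fractal_pre4 (natural_structure f K) K s n =
  ereal_inf [set ((\sum_(w <- W) weight (fun a => c a `^ s) w)%:E * diam_pow s K)%E
    | W in [set W | word_cover W /\ forall w, w \in W -> (n <= size w)%N]].
Proof.
congr ereal_inf; apply/seteqP; split => [h [m [A [AW KA ->]]]|_ [W [KW Wn] <-]].
  have /choice[w wP] : forall i, exists w, (n <= size w)%N /\ A i = piece w.
    by move=> i; have [l [w [nl Aw]]] := AW i; exists w; rewrite size_tuple.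
  exists [seq w i | i <- enum 'I_m]; last first.
    rewrite big_map big_enum/= -sumEFin ge0_sume_distrl => [|i _]; last first.
      by rewrite lee_fin weight_ge0// => a; exact: powR_ge0.
    by apply: eq_bigr => i _; have [_ ->] := wP i; rewrite diam_pow_word.
  split => [x /KA[i _]|_ /mapP[i _ ->]]; last by have [] := wP i.
  have [_ ->] := wP i; exists (w i) => //; apply: map_f; exact: mem_enum.
exists (size W), (fun i => piece (nth [::] W i)); split.
- move=> i; exists (size (nth [::] W i)), (in_tuple (nth [::] W i)); split => //.
  by apply: Wn; exact: mem_nth.
- move=> x /KW[w wW wx]; have wS : (index w W < size W)%N by rewrite index_mem.
  by exists (Ordinal wS) => //=; rewrite nth_index.
- rewrite (big_nth [::]) big_mkord -sumEFin ge0_sume_distrl => [|i _]; last first.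
    by rewrite lee_fin weight_ge0// => a; exact: powR_ge0.
  by apply: eq_bigr => i _; rewrite diam_pow_word.
Qed.

Lemma weight_pow_ge0 s w : 0 <= weight (fun a => c a `^ s) w.
Proof. by apply: weight_ge0 => a; exact: powR_ge0. Qed.

Lemma fractal_pre4_ge0 s n : (0 <= fractal_pre4 (natural_structure f K) K s n)%E.
Proof.
rewrite fractal_pre4E; apply: le_ereal_inf_tmp => _ [W _ <-].
by rewrite mule_ge0 ?diam_pow_ge0// lee_fin sumr_ge0// => w _; exact: weight_pow_ge0.
Qed.

Lemma fractal_pre4_fin s n : fractal_pre4 (natural_structure f K) K s n \is a fin_num.
Proof.
rewrite ge0_fin_numE ?fractal_pre4_ge0// fractal_pre4E.
pose W := [seq tval u | u <- enum {: n.-tuple 'I_k}].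
apply: (@le_lt_trans _ _
  ((\sum_(w <- W) weight (fun a => c a `^ s) w)%:E * diam_pow s K)%E).
  apply: ereal_inf_lbound; exists W => //; split => [x Kx|_ /mapP[u _ ->]].
    have [u ux] := attractor_words n Kx; exists (tval u) => //.
    by apply: map_f; rewrite mem_enum.
  by rewrite size_tuple.
by rewrite -(fineK (diam_pow_attractor_fin s)) -EFinM ltry.
Qed.

Lemma fractal_pre4_nondecreasing s :
  nondecreasing_seq (fractal_pre4 (natural_structure f K) K s).
Proof.
move=> m n mn; rewrite !fractal_pre4E; apply: ereal_inf_le_tmp.
move=> _ [W [KW Wn] <-]; exists W => //; split => // w /Wn; exact: leq_trans.
Qed.

(** Prefixing a cover of depth [m] by the words of [P] gives one of depth [n + m] with its sum
    multiplied by [q < 1]. Since the pre-measure is nondecreasing in the depth, its value at [m] is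
    at most [q] times itself; being finite, it is 0. *)
Lemma fractal_pre4_eq0 s n (P : pred (n.-tuple 'I_k)) :
  (forall x, K x -> exists2 u, P u & piece u x) ->
  \sum_(u | P u) weight (fun a => c a `^ s) u < 1 ->
  forall m, fractal_pre4 (natural_structure f K) K s m = 0%E.
Proof.
move=> KP; set q := (X in X < 1) => q1 m.
have q0 : 0 <= q by apply: sumr_ge0 => u _; exact: weight_pow_ge0.
apply/eqP; rewrite eq_le fractal_pre4_ge0 andbT -(fineK (fractal_pre4_fin s m)) lee_fin.
rewrite -(@ler_pM2l _ (1 - q)) ?subr_gt0// mulr0.
have Hm := fractal_pre4_fin s m; have := fractal_pre4_nondecreasing s (leq_addl n m).
move: Hm; rewrite fractal_pre4E => Hm Hnm; apply: ereal_inf_contraction => //.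
  move=> _ [W _ <-]; rewrite mule_ge0 ?diam_pow_ge0// lee_fin sumr_ge0// => w _.
  exact: weight_pow_ge0.
move=> _ [W [KW Wm] <-]; apply: (le_trans Hnm).
rewrite add0e fractal_pre4E; apply: ereal_inf_lbound.
exists [seq tval u ++ w | u <- enum P, w <- W].
  split => [x /KP[u Pu [y /KW[w wW [z Kz <-]] <-]]|].
    exists (tval u ++ w); last by exists z => //; rewrite word_map_cat.
    by apply: allpairs_f => //; rewrite mem_enum.
  by move=> _ /allpairsP[[u w] /= [_ wW ->]]; rewrite size_cat size_tuple leq_add2l Wm.
rewrite big_allpairs_dep/= muleA -EFinM; congr (_%:E * _)%E.
rewrite big_enum /q mulr_suml; apply: eq_bigr => u _.
by rewrite mulr_sumr; apply: eq_bigr => w _; rewrite weight_cat.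
Qed.

Lemma finite_content_le_pre4 s :
  (finite_content s K <= fractal_pre4 (natural_structure f K) K s 0)%E.
Proof.
rewrite fractal_pre4E; apply: le_ereal_inf_tmp => _ [W [KW _] <-].
apply: ereal_inf_lbound; exists (map piece W).
  by move=> x /KW[w wW wx]; exists (piece w) => //; exact: map_f.
rewrite big_map -sumEFin ge0_sume_distrl => [|w _]; last by rewrite lee_fin weight_pow_ge0.
by apply: eq_bigr => w _; rewrite diam_pow_word.
Qed.

Lemma finite_content_fin s : finite_content s K \is a fin_num.
Proof.
rewrite ge0_fin_numE ?finite_content_ge0// (le_lt_trans (finite_content_le_pre4 s))//.
by rewrite -(fineK (fractal_pre4_fin s 0)) ltry.
Qed.

(** [K] is covered by [B] together with a scaled copy of a nearly optimal cover in each cylinder of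
    [P]. *)
Lemma finite_content_subcover s (a : R) n (P : pred (n.-tuple 'I_k)) (B : set X) :
  (forall x, K x -> B x \/ exists2 u, P u & piece u x) ->
  (diam_pow s B <= a%:E)%E ->
  (1 - \sum_(u | P u) weight (fun a => c a `^ s) u) * fine (finite_content s K) <= a.
Proof.
move=> KP Ba; apply: ereal_inf_contraction.
- by apply: sumr_ge0 => u _; exact: weight_pow_ge0.
- exact: finite_content_fin.
- by move=> _ [L _ <-]; apply: sume_ge0 => U _; exact: diam_pow_ge0.
move=> _ [L KL <-].
pose L' := B :: [seq word_map f (tval u) @` U | u <- enum P, U <- L].
apply: (@le_trans _ _ (\sum_(U <- L') diam_pow s U)%E).
  apply: ereal_inf_lbound; exists L' => // x /KP[Bx|[u Pu [y /KL[U UL Uy] <-]]].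
    by exists B => //; rewrite mem_head.
  exists (word_map f (tval u) @` U); last exact: imageP.
  by rewrite inE; apply/orP; right; apply: allpairs_f => //; rewrite mem_enum.
rewrite big_cons leeD// big_allpairs_dep/= -sumEFin ge0_sume_distrl => [|u _]; last first.
  by rewrite lee_fin weight_pow_ge0.
rewrite le_eqVlt; apply/orP; left; apply/eqP.
rewrite big_enum; apply: eq_bigr => u _.
rewrite ge0_sume_distrr => [|U _]; last exact: diam_pow_ge0.
by apply: eq_bigr => U _; rewrite diam_pow_word.
Qed.

(** At the level of the longest word of [W], the cylinders not below [W] have total weight at most 1
    minus that of [W], and all others lie in [B]. *)
Lemma antichain_bound s (a : R) W (B : set X) : \sum_i c i `^ s = 1 ->
  uniq W -> {in W &, forall v w, prefix v w -> v = w} ->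
  (forall w, w \in W -> piece w `<=` B) -> (diam_pow s B <= a%:E)%E ->
  (\sum_(w <- W) weight (fun i => c i `^ s) w) * fine (finite_content s K) <= a.
Proof.
move=> c1 uW aW WB Ba.
pose n := \max_(w <- W) size w.
have Wn w : w \in W -> (size w <= n)%N.
  by move=> wW; rewrite (@leq_bigmax_seq _ W xpredT size).
have p0 i : 0 <= c i `^ s by exact: powR_ge0.
pose P (u : n.-tuple 'I_k) := ~~ has (fun w => prefix w u) W.
have := @finite_content_subcover s a n P B; set q := \sum_(u | P u) _ => Hq.
apply: le_trans (Hq _ Ba).
  have := sum_weight_antichain p0 c1 Wn uW aW; rewrite -/q => WP.
  by rewrite ler_wpM2r ?fine_ge0 ?finite_content_ge0//; lra.
move=> x Kx; have [u ux] := attractor_words n Kx.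
have [/hasP[w wW wu]|nu] := boolP (has (fun w => prefix w u) W); last by right; exists u.
by left; apply: (WB w wW); exact: piece_prefix ux.
Qed.

Lemma fractal_measure4_eq0 s :
  (forall n, fractal_pre4 (natural_structure f K) K s n = 0%E) ->
  fractal_measure4 (natural_structure f K) K s = 0%E.
Proof.
move=> H0; rewrite /fractal_measure4 (_ : fractal_pre4 _ _ _ = cst 0%E).
  by rewrite lim_cst.
exact/funext.
Qed.

Lemma hausdorff_measure_eq0_pre4 s : 0 < s ->
  fractal_pre4 (natural_structure f K) K s 0 = 0%E -> hausdorff_measure s K = 0%E.
Proof.
move=> s0 K0; apply: hausdorff_measure_eq0 => //; apply/eqP.
by rewrite eq_le finite_content_ge0 andbT -K0 finite_content_le_pre4.
Qed.

(** If a word [u] of level [n] had no prefix in [W], the extensions of words of [W] to length [n]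
    would cover [K] without [u], against irreducibility. *)
Lemma WSC_word_cover s W : \sum_i c i `^ s = 1 -> WSC f K -> word_cover W ->
  1 <= \sum_(w <- W) weight (fun i => c i `^ s) w.
Proof.
(* The successor ensures [n > 0], since irreducibility only speaks of positive levels. *)
move=> c1 wsc KW; pose n := (\max_(w <- W) size w).+1.
have Wn w : w \in W -> (size w <= n)%N.
  by move=> wW; rewrite leqW// (@leq_bigmax_seq _ W xpredT size).
apply: (sum_weight_ge1 _ c1 Wn) => [i|u]; first exact: powR_ge0.
apply: contrapT => /negP nu; apply: (wsc n _ u) => //; apply/seteqP; split.
  by move=> x [v _]; exact: piece_sub.
move=> x /KW[w wW [y /(attractor_words (n - size w))[t yt] <-]].
have wtn : size (w ++ t) == n by rewrite size_cat size_tuple subnKC// Wn.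
exists (Tuple wtn) => /=.
  apply/eqP => wtu; move/hasPn: nu => /(_ _ wW) /negP; apply.
  by rewrite -wtu /= prefix_prefix.
by rewrite /natural_structure -/(piece _) /= piece_cat; exact: imageP.
Qed.

(** * Varying the exponent, and the failure of WSC *)

Lemma powR_lt (a s t : R) : 0 < a < 1 -> s < t -> a `^ t < a `^ s.
Proof.
move=> /andP[a0 a1] st; rewrite /powR gt_eqF// ltr_expR ltr_nM2r//.
by rewrite ln_lt0// a0.
Qed.

Lemma sum_powR_lt (s t : R) : (0 < k)%N -> s < t ->
  \sum_i c i `^ t < \sum_i c i `^ s.
Proof.
move=> k0 st; apply: ltr_sum; last by move=> i _; exact: powR_lt.
by apply/hasP; exists (Ordinal k0); rewrite // mem_index_enum.
Qed.

Lemma sum_powR_lt1 (I : finType) (P : pred I) (a : I -> R) (t : R) :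
  (forall i, 0 < a i) -> 0 < t -> \sum_(i | P i) a i `^ t < 1 ->
  exists2 s, 0 < s < t & \sum_(i | P i) a i `^ s < 1.
Proof.
move=> a0 t0 at1.
have ct : continuous (fun s => \sum_(i | P i) a i `^ s : R).
  apply: continuous_big => [|i _]; first exact: add_continuous.
  rewrite (_ : (fun s => _) = (fun s => expR (s * ln (a i)))); last first.
    by apply/funext => s; rewrite /powR gt_eqF.
  move=> s; apply: continuous_comp; last exact: continuous_expR.
  exact: mulrr_continuous.
have /nbhs_ballP[e /= e0 te] : nbhs t (fun s => \sum_(i | P i) a i `^ s < 1).
  exact: cvgr_lt (ct t) _ at1.
(* [e / 2] keeps [s] in the neighborhood given by continuity, [t / 2] keeps it positive. *)
exists (t - Num.min (e / 2) (t / 2)).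
  by have [] := lerP (e / 2) (t / 2); lra.
apply: te; rewrite /ball/= opprB addrCA subrr addr0 ger0_norm.
  by rewrite gt_min; apply/orP; left; lra.
by rewrite le_min; apply/andP; split; lra.
Qed.

Lemma not_WSC_subcover t : \sum_i c i `^ t = 1 -> ~ WSC f K ->
  exists n (P : pred (n.-tuple 'I_k)),
    (forall x, K x -> exists2 u, P u & piece u x) /\
    \sum_(u | P u) weight (fun i => c i `^ t) u < 1.
Proof.
move=> c1 nWSC.
have [n [i Ki]] : exists n, exists i : n.-tuple 'I_k,
    \bigcup_(j in [set j : n.-tuple 'I_k | j != i]) piece j = K.
  apply: contrapT => nK; apply: nWSC => n n0 i Ki; apply: nK.
  by exists n, i.
exists n, (fun j => j != i); split.
  by move=> x; rewrite -{1}Ki => -[j /= ji xj]; exists j.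
have := sum_weight (fun a => c a `^ t) n; rewrite c1 expr1n (bigD1 i)//= => <-.
by rewrite ltrDr weight_gt0// => a; rewrite powR_gt0 ?c_gt0.
Qed.

(** A subcover missing a word has weight below 1 at [t], and by continuity still at a smaller
    exponent. *)
Lemma not_WSC_pre4 t : 0 < t -> \sum_i c i `^ t = 1 -> ~ WSC f K ->
  exists2 s, 0 < s < t & forall m, fractal_pre4 (natural_structure f K) K s m = 0%E.
Proof.
move=> t0 c1 /(not_WSC_subcover c1)[n [P [KP P1]]].
have [||s st s1] := @sum_powR_lt1 _ P (weight c) t _ t0.
- by move=> j; apply: weight_gt0 c_gt0.
- by under eq_bigr do rewrite (weight_powR _ _ c_gt0).
exists s => //; apply: (fractal_pre4_eq0 KP).
by under eq_bigr do rewrite -(weight_powR _ _ c_gt0).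
Qed.

(** Above [t] the whole first level already has total weight below 1. *)
Lemma pre4_above s t m : (0 < k)%N -> \sum_i c i `^ t = 1 -> t < s ->
  fractal_pre4 (natural_structure f K) K s m = 0%E.
Proof.
move=> k0 c1 ts; apply: (@fractal_pre4_eq0 s 1 xpredT) => [x /(attractor_words 1)[u]|].
  by exists u.
by rewrite sum_weight expr1 -c1 sum_powR_lt.
Qed.

(** * From SOSC to positive content below the similarity dimension *)

Lemma weight_small (e : R) : 0 < e ->
  exists n, forall w, size w = n -> weight c w < e.
Proof.
move=> e0; pose m := \big[Num.max/0]_i c i.
have cm i : c i <= m by exact: le_bigmax.
have m01 : 0 <= m < 1.
  by rewrite bigmax_ge_id/=; apply: bigmax_lt => // i _; have /andP[] := c01 i.
have [n _ mn] := expr_lt_eventually m01 e0; exists n => w wn.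
apply: le_lt_trans mn; rewrite -{}wn; elim: w => [|a w IH].
  by rewrite weight_nil expr0.
by rewrite weight_cons/= exprS ler_pM ?c_ge0// weight_ge0// => i; exact: c_ge0.
Qed.

Lemma mdist_piece w x y (D : R) : (diam K <= D%:E)%E ->
  piece w x -> piece w y -> mdist x y <= weight c w * D.
Proof.
move=> KD wx wy; rewrite -lee_fin (le_trans (mdist_le_diam wx wy))//.
rewrite diam_word EFinM lee_wpmul2l// lee_fin ltW// weight_gt0//.
exact: c_gt0.
Qed.

Lemma small_piece x (e : R) : K x -> 0 < e ->
  exists w, piece w `<=` [set y | mdist x y < e].
Proof.
have [_ cK _] := Katt; have [D D0 KD] := compact_diam cK.
(* [D] may be 0, so [D + 1] serves as the divisor. *)
move=> Kx e0; have D1 : 0 < D + 1 by rewrite ltr_wpDl.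
have [n nP] := weight_small (divr_gt0 e0 D1).
have [u ux] := attractor_words n Kx; exists u => y uy /=.
have KD' : (diam K <= (D + 1)%:E)%E by rewrite KD lee_fin lerDl.
apply: (le_lt_trans (mdist_piece KD' ux uy)).
by rewrite -ltr_pdivlMr// nP// size_tuple.
Qed.

Lemma compact_piece w : compact (piece w).
Proof.
have [_ cK _] := Katt; apply: continuous_compact cK.
apply: continuous_subspaceT; apply: similitude_continuous (similitude_word w).
exact: weight_gt0 c_gt0.
Qed.

Lemma f_inj i : injective (f i).
Proof. exact: similitude_inj (c_gt0 i) (fc i). Qed.

Lemma feasible_word V w x : feasible_open f V -> V x -> V (word_map f w x).
Proof.
by move=> [_ _ _ fV] Vx; elim: w => //= a w IH; apply: fV; exact: imageP.
Qed.

(** The first letters agree because the images of [V] are disjoint; injectivity cancels them. *)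
Lemma feasible_word_inj V v w x y : feasible_open f V -> V x -> V y ->
  size v = size w -> word_map f v x = word_map f w y -> v = w.
Proof.
move=> Vf Vx Vy; have [_ _ tV _] := Vf.
elim: v w => [|a v IH] [|b w]//= [vw] fvw.
have ab : a = b.
  apply: tV => //; exists (f a (word_map f v x)); split.
    by apply: imageP; exact: feasible_word.
  by rewrite fvw; apply: imageP; exact: feasible_word.
by move: fvw; rewrite ab => /f_inj /(IH _ vw) ->.
Qed.

Lemma positive_separation (J : finType) (F : J -> set X) :
  (forall j, compact (F j)) -> (forall i j, i != j -> F i `&` F j = set0) ->
  exists2 e : R, 0 < e &
    forall i j, i != j -> forall x y, F i x -> F j y -> e <= mdist x y.
Proof.
move=> cF dF.
have /choice[e eP] : forall p : J * J, exists e : R, 0 < e /\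
    (p.1 != p.2 -> forall x y, F p.1 x -> F p.2 y -> e <= mdist x y).
  move=> [i j] /=; have [_|ij] := eqVneq i j; first by exists 1.
  by have [e e0 eP] := compact_disjoint_mdist (cF i) (cF j) (dF _ _ ij); exists e.
exists (\big[Num.min/1]_p e p); first by apply: lt_bigmin => // p _; have [] := eP p.
move=> i j ij x y Fx Fy; apply: (@le_trans _ _ (e (i, j))); first exact: bigmin_le.
by have [_] := eP (i, j); apply.
Qed.

(** With [piece w] inside [V], the pieces [piece (u ++ w)] for [u] of length [n] are compact and
    disjoint, hence separated, and [separated_cover_bound] applies to their maps. *)
Lemma SOSC_finite_content (s t : R) : (1 < k)%N -> \sum_i c i `^ t = 1 ->
  0 <= s < t -> SOSC f K -> (0 < finite_content s K)%E.
Proof.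
move=> k1 ct /andP[s0 st] [V [Vf [x [Vx Kx]]]].
have k0 : (0 < k)%N by exact: ltnW.
have [oV _ _ _] := Vf; have [K0 cK _] := Katt.
have [e /= e0 eV] : nbhs_ball x V by apply/nbhs_ballP; exact: open_nbhs_nbhs.
have [w wx] := small_piece Kx e0.
have wV : piece w `<=` V by move=> y /wx xy; apply: eV; rewrite ballEmdist.
pose q := \sum_i c i `^ s; have q1 : 1 < q by rewrite -ct sum_powR_lt.
have q0 : 0 < q by apply: lt_trans q1.
have ww0 : 0 < weight (fun i => c i `^ s) w.
  by apply: weight_gt0 => i; rewrite powR_gt0 ?c_gt0.
have qV : 0 <= q^-1 < 1 by rewrite invr_ge0 ltW//= invf_lt1.
(* The [s]-th powers of the ratios sum to [q ^+ n] times the weight of [w]; this [n] makes the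
   product exceed 1, and [n > 0] gives at least two maps. *)
have [n n0 nP] := expr_lt_eventually qV ww0.
pose g (u : n.-tuple 'I_k) := word_map f (u ++ w).
have [h h0 hP] : exists2 h : R, 0 < h & forall u v : n.-tuple 'I_k, u != v ->
    forall x y, piece (u ++ w) x -> piece (v ++ w) y -> h <= mdist x y.
  apply: (positive_separation (F := fun u : n.-tuple 'I_k => piece (u ++ w))).
    by move=> u; exact: compact_piece.
  move=> u v /eqP uv; apply/seteqP; split => // z.
  rewrite !piece_cat => -[[y1 wy1 uy1] [y2 wy2 vy2]]; apply: uv; apply: val_inj => /=.
  apply: (feasible_word_inj Vf (wV _ wy1) (wV _ wy2)); first by rewrite !size_tuple.
  by rewrite uy1 vy2.
apply: (@lt_le_trans _ _ (h `^ s)%:E); first by rewrite lte_fin powR_gt0.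
apply: le_ereal_inf_tmp => _ [L KL <-].
apply: (@separated_cover_bound _ _ _ g (fun u => weight c (u ++ w))) KL => //.
- by rewrite card_tuple card_ord -(exp1n n) ltn_exp2r.
- by move=> u; apply: weight_gt0 c_gt0.
- by move=> u; exact: similitude_word.
- by move=> u; exact: piece_sub.
- under eq_bigr do rewrite (weight_powR _ _ c_gt0) weight_cat.
  rewrite -mulr_suml sum_weight -/q mulrC -ler_pdivrMr ?exprn_gt0//.
  by rewrite mul1r -exprVn ltW.
- by move=> u v uv y z Ky Kz; apply: (hP _ _ uv); exact: imageP.
Qed.

Lemma SOSC_hausdorff_dim_ge (t : R) : (1 < k)%N -> \sum_i c i `^ t = 1 ->
  SOSC f K -> (t%:E <= hausdorff_dim K)%E.
Proof.
move=> k1 ct sosc; apply: le_ereal_inf_tmp => _ [s [s0 Hs] <-].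
rewrite lee_fin leNgt; apply/negP => st; have [_ cK _] := Katt.
have := @SOSC_finite_content s t k1 ct; rewrite s0 st => /(_ isT sosc).
by rewrite (finite_content_eq0 s0 cK Hs) ltxx.
Qed.

(** * Neighbors of a word, and SOSC from positive content *)

(* The first condition says that p is the shortest of its nonempty prefixes with
   ratio at most that of w; such words form an antichain. *)
Definition neighbor w p := exists v a, [/\ p = rcons v a,
  weight c w < weight c v, weight c p <= weight c w
  & exists x y, [/\ piece w x, piece p y & mdist x y < weight c w]].

Lemma neighbor_antichain w p q :
  neighbor w p -> neighbor w q -> prefix p q -> p = q.
Proof.
move=> [_ [_ [_ _ pw _]]] [v [a [-> wv _ _]]] /prefixP[t].
case/lastP: t => [|t b]; first by rewrite cats0.
rewrite -rcons_cat => /rcons_inj[vE _]; exfalso.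
move: wv; apply/negP; rewrite -leNgt; apply: le_trans pw.
rewrite vE weight_cat ger_pMr; first exact: weight_le1.
exact: weight_gt0 c_gt0.
Qed.

Lemma neighbor_cat u w p : neighbor w p -> neighbor (u ++ w) (u ++ p).
Proof.
have u0 : 0 < weight c u := weight_gt0 u c_gt0.
move=> [v [a [-> wv pw [x [y [wx py xy]]]]]]; exists (u ++ v), a; split.
- by rewrite rcons_cat.
- by rewrite !weight_cat ltr_pM2l.
- by rewrite !weight_cat ler_pM2l.
exists (word_map f u x), (word_map f u y).
by rewrite !piece_cat similitude_word weight_cat ltr_pM2l.
Qed.

(** The radius adds the diameters of the two pieces, each at most [weight c w * D], and the gap,
    below [weight c w]. *)
Lemma neighbor_piece_sub w p z (D : R) : (diam K <= D%:E)%E -> piece w z ->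
  neighbor w p -> piece p `<=` [set x | mdist z x <= weight c w * (2 * D + 1)].
Proof.
move=> KD wz [_ [_ [_ _ pw [x [y [wx py xy]]]]]] t pt /=.
have D0 : 0 <= D by rewrite -lee_fin (le_trans _ KD) ?diam_ge0.
have h1 := mdist_piece KD wz wx; have h2 := mdist_piece KD py pt.
have h3 := metric_triangle z x t; have h4 := metric_triangle x y t.
have h5 : weight c p * D <= weight c w * D by rewrite ler_wpM2r.
by lra.
Qed.

Lemma neighbor_weight_gt w p (m : R) : (forall i, m <= c i) -> neighbor w p ->
  weight c w * m <= weight c p.
Proof.
move=> mc [v [a [-> wv _ _]]]; rewrite weight_rcons.
have w0 : 0 < weight c w := weight_gt0 w c_gt0.
apply: (@le_trans _ _ (weight c w * c a)); first by rewrite ler_pM2l.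
by rewrite ler_wpM2r ?c_ge0// ltW.
Qed.

(** The neighbors of [w] form an antichain with pieces in a ball of radius comparable to
    [weight c w], and their ratios are comparable to it too. [antichain_bound] then limits their
    number, the scale of [w] cancelling. *)
Lemma neighbor_count (s : R) : 0 <= s -> \sum_i c i `^ s = 1 ->
  (0 < finite_content s K)%E ->
  exists M : nat, forall w W, uniq W -> (forall p, p \in W -> neighbor w p) ->
    (size W <= M)%N.
Proof.
move=> s0 cs K0; have [[x0 Kx0] cK _] := Katt; have [D D0 KD] := compact_diam cK.
pose m := \big[Num.min/1]_i c i.
have mc i : m <= c i by exact: bigmin_le.
have m0 : 0 < m by apply: lt_bigmin => // i _; exact: c_gt0.
pose kappa := fine (finite_content s K).
have kappa0 : 0 < kappa by rewrite -lte_fin fineK ?finite_content_fin.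
(* Twice the radius factor [2 * D + 1] of [neighbor_piece_sub]. *)
pose C := 4 * D + 2.
have C0 : 0 <= C by rewrite /C; lra.
have mkappa : 0 < m `^ s * kappa by rewrite mulr_gt0// powR_gt0.
exists (Num.bound (C `^ s / (m `^ s * kappa))) => w W uW WP.
have w0 : 0 < weight c w := weight_gt0 w c_gt0.
pose z := word_map f w x0.
have wz : piece w z by exact: imageP.
pose B := [set x | mdist z x <= weight c w * (2 * D + 1)].
have KD' : (diam K <= D%:E)%E by rewrite KD.
have dB : (diam_pow s B <= ((weight c w * C) `^ s)%:E)%E.
  rewrite -poweR_EFin; apply: (diam_pow_le s0); apply: diam_le => [|x y Bx By].
    by rewrite lee_fin mulr_ge0// ltW.
  have := metric_triangle x z y; rewrite (metric_sym x z) => xzy.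
  by rewrite lee_fin (le_trans xzy)// (le_trans (lerD Bx By))// /C; lra.
have WB p : p \in W -> piece p `<=` B by move=> /WP; exact: neighbor_piece_sub.
have aW : {in W &, forall v w, prefix v w -> v = w}.
  by move=> p q /WP wp /WP wq; exact: neighbor_antichain wp wq.
have := antichain_bound cs uW aW WB dB; rewrite -/kappa => WC.
have Wm : (weight c w * m) `^ s * (size W)%:R <=
    \sum_(p <- W) weight (fun i => c i `^ s) p.
  rewrite mulr_natr -(count_predT W) -[leLHS]addr0 -iter_addr -big_const_seq.
  rewrite [leLHS]big_seq [leRHS]big_seq; apply: ler_sum => p pW.
  rewrite -(weight_powR _ _ c_gt0); apply: ge0_ler_powR => //.
  - by rewrite nnegrE mulr_ge0 ?(ltW w0) ?(ltW m0).
  - by rewrite nnegrE ltW// weight_gt0//; exact: c_gt0.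
  - exact: neighbor_weight_gt (WP _ pW).
have : (weight c w * m) `^ s * (size W)%:R * kappa <= (weight c w * C) `^ s.
  by apply: le_trans WC; rewrite ler_wpM2r// ltW.
rewrite !powRM ?(ltW w0) ?(ltW m0)// -!mulrA ler_pM2l ?powR_gt0// => WMC.
rewrite -(ler_nat R) ltW//; apply: le_lt_trans (archi_boundP _); last first.
  by rewrite divr_ge0// ?powR_ge0// ltW.
by rewrite ler_pdivlMr// mulrCA.
Qed.

Lemma stopping_prefix p (r : R) : weight c p <= r -> r < 1 ->
  exists v a, [/\ prefix (rcons v a) p, weight c (rcons v a) <= r & r < weight c v].
Proof.
move=> + r1; elim/last_ind: p => [|p a IH].
  by rewrite weight_nil leNgt r1.
move=> pr; have [pr'|rp] := leP (weight c p) r; last by exists p, a; rewrite prefix_refl.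
have [v [b [vp vr rv]]] := IH pr'; exists v, b; split => //.
by apply: prefix_trans vp _; exact: prefix_rcons.
Qed.

(** [w] has the largest number of neighbors. Prefixing them by [u] gives as many neighbors of
    [u ++ w], so any further one would contradict maximality. *)
Lemma maximal_neighbor_word (s : R) : (0 < k)%N -> 0 <= s ->
  \sum_i c i `^ s = 1 -> (0 < finite_content s K)%E ->
  exists2 w, w != [::] & forall u p, neighbor (u ++ w) p -> prefix u p.
Proof.
move=> k0 s0 cs K0; have [M MP] := neighbor_count s0 cs K0.
pose P n := `[< exists w W, [/\ w != [::], uniq W,
  (forall p, p \in W -> neighbor w p) & size W = n] >].
have exP : exists n, P n.
  by exists 0%N; apply/asboolP; exists [:: Ordinal k0], [::].
have leP n : P n -> (n <= M)%N by move=> /asboolP[w [W [_ uW WP <-]]]; exact: MP WP.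
case: (ex_maxnP exP leP) => n /asboolP[w [W [w0 uW WP Wn]]] nmax.
exists w => // u p up.
have [/mapP[q _ ->]|pW] := boolP (p \in map (cat u) W); first exact: prefix_prefix.
have : (n.+1 <= n)%N; last by rewrite ltnn.
apply: nmax; apply/asboolP; exists (u ++ w), (p :: map (cat u) W); split.
- by case: (u).
- by rewrite /= pW map_inj_uniq// => q q' /eqP; rewrite eqseq_cat// eqxx => /eqP.
- by move=> q; rewrite inE => /predU1P[->//|/mapP[q' /WP wq' ->]]; exact: neighbor_cat.
- by rewrite /= size_map Wn.
Qed.

(** Cutting [j :: v ++ w] where its ratio first drops to that of [i :: u ++ w] yields a neighbor of
    the latter, which by maximality begins with [i :: u]. *)
Lemma piece_separation w i j u v x y : w != [::] ->
  (forall u p, neighbor (u ++ w) p -> prefix u p) ->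
  piece (i :: u ++ w) x -> piece (j :: v ++ w) y ->
  weight c (j :: v ++ w) <= weight c (i :: u ++ w) ->
  mdist x y < weight c (i :: u ++ w) -> i = j.
Proof.
move=> w0 wmax ux vy vu xy.
have u1 : weight c (i :: u ++ w) < 1 by exact: weight_lt1.
have [v' [a [v'p v'r rv']]] := stopping_prefix vu u1.
have /(wmax (i :: u)) : neighbor ((i :: u) ++ w) (rcons v' a).
  by exists v', a; split => //; exists x, y; split => //; exact: piece_prefix vy.
by case: v' v'p {v'r rv'} => [|b v'] /= /andP[/eqP -> _] /andP[/eqP ->].
Qed.

Lemma finite_content_SOSC (s : R) : (0 < k)%N -> 0 <= s ->
  \sum_i c i `^ s = 1 -> (0 < finite_content s K)%E -> SOSC f K.
Proof.
move=> k0 s0 cs K0; have [w w0 wmax] := maximal_neighbor_word k0 s0 cs K0.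
pose V := [set x | exists u y, piece (u ++ w) y /\ mdist y x < weight c (u ++ w) / 2].
have Vpiece u y : piece (u ++ w) y -> V y.
  move=> uy; exists u, y; split => //; rewrite mdistxx divr_gt0//.
  exact: weight_gt0 c_gt0.
have [[x0 Kx0] _ _] := Katt.
have wx0 : piece ([::] ++ w) (word_map f w x0) by exact: imageP.
exists V; split; last first.
  by exists (word_map f w x0); split; [exact: Vpiece wx0|exact: word_map_attractor].
split.
- rewrite openE => x [u [y [uy yx]]]; apply/nbhs_ballP.
  exists (weight c (u ++ w) / 2 - mdist y x) => /=; first by rewrite subr_gt0.
  move=> z; rewrite ballEmdist/= ltrBrDl => xz; exists u, y; split => //.
  exact: le_lt_trans (metric_triangle y x z) xz.
- by exists (word_map f w x0); exact: Vpiece wx0.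
- move=> i j _ _ [_ [[x [u [y [uy yx]]] <-] [x' [v [y' [vy yx']]] xx']]].
  have uy' : piece (i :: u ++ w) (f i y) by rewrite -cat1s piece_cat; exact: imageP.
  have vy' : piece (j :: v ++ w) (f j y') by rewrite -cat1s piece_cat; exact: imageP.
  have dy : mdist (f i y) (f i x) < weight c (i :: u ++ w) / 2.
    by rewrite fc weight_cons -mulrA ltr_pM2l ?c_gt0.
  have dy' : mdist (f j y') (f i x) < weight c (j :: v ++ w) / 2.
    by rewrite -xx' fc weight_cons -mulrA ltr_pM2l ?c_gt0.
  have h1 := metric_triangle (f i y) (f i x) (f j y').
  have h2 := metric_sym (f i x) (f j y'); have h3 := metric_sym (f i y) (f j y').
  (* The two points are closer than half the sum of the ratios, hence closer than the larger
     ratio. *)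
  have [vu|/ltW uv] := leP (weight c (j :: v ++ w)) (weight c (i :: u ++ w)).
    by apply: (piece_separation w0 wmax uy' vy' vu); lra.
  by apply/esym/(piece_separation w0 wmax vy' uy' uv); lra.
- move=> i _ [x [u [y [uy yx]]] <-]; exists (i :: u), (f i y); split.
    by rewrite cat_cons -cat1s piece_cat; exact: imageP.
  by rewrite fc cat_cons weight_cons -mulrA ltr_pM2l ?c_gt0.
Qed.

Lemma hausdorff_measure_SOSC (s : R) : (0 < k)%N -> 0 < s ->
  \sum_i c i `^ s = 1 -> (0 < hausdorff_measure s K)%E -> SOSC f K.
Proof.
move=> k0 s0 cs Hs; apply: (finite_content_SOSC k0 (ltW s0) cs).
rewrite lt_neqAle finite_content_ge0 andbT eq_sym; apply/eqP => K0.
by move: Hs; rewrite (hausdorff_measure_eq0 s0 K0) ltxx.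
Qed.

(** * The implications at the similarity dimension *)

Section similarity_dimension.
Context (alpha : R) (k2 : (2 <= k)%N) (calpha : is_similarity_dim c alpha).

Let alpha_gt0 : 0 < alpha. Proof. by have [] := calpha. Qed.
Let c_alpha : \sum_i c i `^ alpha = 1. Proof. by have [] := calpha. Qed.
Let k_gt0 : (0 < k)%N. Proof. exact: ltnW. Qed.

(** If [K] were a point, a single letter would cover it with weight below 1. *)
Lemma WSC_diam_gt0 : WSC f K -> (0 < diam K)%E.
Proof.
move=> wsc; rewrite lt_neqAle diam_ge0 andbT eq_sym; apply/eqP => K0.
pose i := Ordinal k_gt0.
suff : word_cover [:: [:: i]].
  move=> /(WSC_word_cover c_alpha wsc); rewrite big_seq1 weight_cons weight_nil.
  by rewrite mulr1 leNgt -(powRr0 (c i)) powR_lt.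
move=> x Kx; exists [:: i]; rewrite ?mem_head//; exists x => //.
apply: mdist_positivity; apply/eqP; rewrite eq_le mdist_ge0 andbT.
by have := mdist_le_diam (word_map_attractor [:: i] Kx) Kx; rewrite K0 lee_fin.
Qed.

(** Ratios are at most 1, so lowering the exponent from [alpha] to [s] only increases the weights,
    which sum to at least 1 at [alpha]. *)
Lemma WSC_measure4_ge s : s <= alpha -> WSC f K ->
  (diam_pow s K <= fractal_measure4 (natural_structure f K) K s)%E.
Proof.
move=> sa wsc; apply: lime_ge.
  exact: ereal_nondecreasing_is_cvgn (fractal_pre4_nondecreasing s).
apply: nearW => n; rewrite fractal_pre4E; apply: le_ereal_inf_tmp => _ [W [KW _] <-].
rewrite -[leLHS]mul1e lee_wpmul2r ?diam_pow_ge0// lee_fin.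
apply: (le_trans (WSC_word_cover c_alpha wsc KW)); apply: ler_sum => w _.
rewrite -!(weight_powR _ _ c_gt0) ger_powR// weight_gt0 ?weight_le1//.
exact: c_gt0.
Qed.

Lemma WSC_measure4_gt0 s : s <= alpha -> WSC f K ->
  (0 < fractal_measure4 (natural_structure f K) K s)%E.
Proof.
move=> sa wsc; apply: lt_le_trans (WSC_measure4_ge sa wsc).
by rewrite diam_powE ?poweR_gt0 ?WSC_diam_gt0//; have [] := Katt.
Qed.

Lemma WSC_iff_measure4 :
  WSC f K <-> (0 < fractal_measure4 (natural_structure f K) K alpha)%E.
Proof.
split=> [|K4]; first exact: WSC_measure4_gt0.
apply: contrapT => /(not_WSC_subcover c_alpha)[n [P [KP P1]]].
by move: K4; rewrite (fractal_measure4_eq0 (fractal_pre4_eq0 KP P1)) ltxx.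
Qed.

(** The measure always vanishes above [alpha]; WSC keeps it positive up to [alpha], and without WSC
    it already vanishes at some smaller exponent. *)
Lemma WSC_iff_dim4 :
  WSC f K <-> fractal_dim4 (natural_structure f K) K = alpha%:E.
Proof.
split=> [wsc|K4].
  apply/eqP; rewrite eq_le; apply/andP; split.
    apply/lee_addgt0Pr => e e0; apply: ereal_inf_lbound; exists (alpha + e) => //.
    split; first by rewrite addr_ge0// ltW.
    apply: fractal_measure4_eq0 => m; apply: (pre4_above _ k_gt0 c_alpha).
    by rewrite ltrDl.
  apply: le_ereal_inf_tmp => _ [s [s0 Ks] <-]; rewrite lee_fin leNgt.
  apply/negP => /ltW/WSC_measure4_gt0/(_ wsc); by rewrite Ks ltxx.
apply: contrapT => /(not_WSC_pre4 alpha_gt0 c_alpha)[s /andP[s0 sa] H0].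
have : (fractal_dim4 (natural_structure f K) K <= s%:E)%E.
  apply: ereal_inf_lbound; exists s => //.
  by split; [exact: ltW|exact: fractal_measure4_eq0].
by rewrite K4 lee_fin leNgt sa.
Qed.

Lemma hausdorff_dim_le : (hausdorff_dim K <= alpha%:E)%E.
Proof.
apply/lee_addgt0Pr => e e0; apply: ereal_inf_lbound; exists (alpha + e) => //.
split; first by rewrite addr_ge0// ltW.
apply: hausdorff_measure_eq0_pre4; first by rewrite addr_gt0.
by apply: (pre4_above _ k_gt0 c_alpha); rewrite ltrDl.
Qed.

Lemma hausdorff_dim_WSC : hausdorff_dim K = alpha%:E -> WSC f K.
Proof.
move=> K4.
apply: contrapT => /(not_WSC_pre4 alpha_gt0 c_alpha)[s /andP[s0 sa] H0].
have : (hausdorff_dim K <= s%:E)%E.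
  apply: ereal_inf_lbound; exists s => //.
  by split; [exact: ltW|exact: hausdorff_measure_eq0_pre4].
by rewrite K4 lee_fin leNgt sa.
Qed.

End similarity_dimension.
End self_similar_set.

Theorem corollary10p6 (R : realType) (X : completeMetricType R) (k : nat)
    (f : 'I_k -> X -> X) (c : 'I_k -> R) (K : set X) (alpha : R) :
  (2 <= k)%N ->
  (forall i, 0 < c i < 1) ->
  (forall i, similitude (c i) (f i)) ->
  is_attractor f K ->
  is_similarity_dim c alpha ->
  let Gamma := natural_structure f K in
  [/\ (0 < hausdorff_measure alpha K)%E -> SOSC f K,
      SOSC f K -> hausdorff_dim K = alpha%:E,
      hausdorff_dim K = alpha%:E -> WSC f K,
      WSC f K <-> (0 < fractal_measure4 Gamma K alpha)%E
    & (0 < fractal_measure4 Gamma K alpha)%E <->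
      fractal_dim4 Gamma K = alpha%:E].
Proof.
move=> k2 c01 fc Katt calpha Gamma; have [a0 c1] := calpha; have k0 := ltnW k2.
split.
- exact: hausdorff_measure_SOSC.
- move=> sosc; apply/eqP; rewrite eq_le.
  rewrite (hausdorff_dim_le c01 fc Katt k2 calpha)/=.
  exact: (SOSC_hausdorff_dim_ge c01 fc Katt k2 c1 sosc).
- exact: hausdorff_dim_WSC calpha.
- exact: WSC_iff_measure4 calpha.
- have m4 := WSC_iff_measure4 c01 fc Katt k2 calpha.
  have d4 := WSC_iff_dim4 c01 fc Katt k2 calpha.
  by split => [/m4/d4|/d4/m4].
Qed.
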